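(* Any trajectory $(q(t),X(t),\mu(t),r(t))$ of the elastic-demand dynamics \begin{align*} \dot{q}_j &= \sum_{i=1}^m x_{ij} - \frac{q_j}{T}, \quad j=1,\ldots,n,\\ \mu_j(q_j) &= T\left[1-\frac{c_j}{q_j}\right]^+, \quad j=1,\ldots,n,\\ x_{ij} &= r_i\,\delta_{ij}(\mu),\qquad \delta_{ij}(\mu)=\frac{e^{-(\kappa_{ij}+\mu_j)/\epsilon}}{\sum_{k=1}^n e^{-(\kappa_{ik}+\mu_k)/\epsilon}},\\ r_i &= \bar{r}_i\, p_i\big(\varphi^i_\epsilon(\mu)\big),\qquad \varphi^i_\epsilon(\mu)=-\epsilon\log\Big(\sum_{j=1}^n e^{-(\kappa_{ij}+\mu_j)/\epsilon}\Big), \end{align*} converges asymptotically to the (unique) equilibrium point $(X^*,q^*,\mu^*,r^* )$ of these dynamics, which is characterized as follows: $(r^*,\mu^* )$ is the unique saddle point (minimum in $r$, maximum in $\mu$) over $r\in\prod_{i=1}^m[0,\bar r_i]$, $\mu\in[0,T)^n$ of \[ W(r,\mu)=\sum_i\big[r_i\varphi^i_\epsilon(\mu)-U_i(r_i)\big]+\sum_j c_j\log\Big(1-\frac{\mu_j}{T}\Big), \] and, given $r^*$, $(X^*,q^* )$ is the unique solution of the convex program \[ \min_{X,q}\ \sum_{i,j}\kappa_{ij}x_{ij}+\sum_j\beta_j(q_j)+\epsilon\sum_{i,j}x_{ij}\log\Big(\frac{x_{ij}}{r^*_i}\Big) \] subject to $x_{ij}\ge 0$, $\sum_j x_{ij}=r^*_i$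 for all $i$, and $\sum_i x_{ij}=q_j/T$ for all $j$, where $\beta_j(q_j)=\int_0^{q_j}[1-c_j/\sigma]^+\,d\sigma$.
   Context: There are $n$ EV charging stations with capacities $c_j>0$ and $m$ demand locations with exogenous constant transport times $\kappa_{ij}$; $T>0$ is the mean sojourn time, $\epsilon>0$ a smoothing parameter, and $[\cdot]^+=\max\{\cdot,0\}$. $q_j$ is the queue at station $j$, $\mu_j$ its waiting delay, $x_{ij}$ the rate from location $i$ to station $j$. Demand at location $i$ is elastic: $\bar r_i>0$ is the maximum request rate and $p_i(\tau)=\mathcal{P}(T_i>\tau)$ is the complementary CDF of an absolutely continuous willingness-to-wait variable $T_i$, continuous and decreasing from 1 to 0 on $[0,\infty)$. The utility $U_i$ is increasing and concave with $r_i=\arg\max_{r_i\ge0}[U_i(r_i)-\tau_i r_i]=\bar r_i p_i(\tau_i)$ (i.e. $U_i'$ is the inverse of $\tau\mapsto \bar r_i p_i(\tau)$), and $U_i$ is assumed strictly concave on $[0,\bar r_i]$. The dynamics have a globally Lipschitz right-hand side in $q$, so solutions exist, are unique and defined for all time. *)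

(* Defs.v *)
(* R : realType, indices 'I_m (locations), 'I_n (stations). *)
From HB Require Import structures.
From mathcomp Require Import all_boot all_order all_algebra.
From mathcomp Require Import all_classical all_reals all_analysis.
Set Implicit Arguments. Unset Strict Implicit. Unset Printing Implicit Defensive.
Import Order.TTheory GRing.Theory Num.Theory.
Import numFieldNormedType.Exports.
Local Open Scope classical_set_scope.
Local Open Scope ring_scope.

Section EV.
Variable R : realType.

(* waiting delay mu_j(q_j) = T [1 - c_j/q_j]^+ ; for q_j <= c_j the bracket is
   nonpositive (and for q_j <= 0 the positive part is 0 by continuity), so 0. *)
Definition mu_of (T c q : R) : R := if q <= c then 0 else T * (1 - c / q).

Definition mu_vec n (T : R) (c q : 'I_n -> R) : 'I_n -> R :=
  fun j => mu_of T (c j) (q j).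

Definition Zsum m n (eps : R) (kappa : 'I_m -> 'I_n -> R) (mu : 'I_n -> R)
  (i : 'I_m) : R := \sum_(k < n) expR (- (kappa i k + mu k) / eps).

Definition phi m n (eps : R) kappa (mu : 'I_n -> R) (i : 'I_m) : R :=
  - eps * ln (@Zsum m n eps kappa mu i).

Definition delta m n (eps : R) kappa (mu : 'I_n -> R) (i : 'I_m) (j : 'I_n) : R :=
  expR (- (kappa i j + mu j) / eps) / @Zsum m n eps kappa mu i.

Definition rate m n (eps : R) kappa (rbar : 'I_m -> R) (p : 'I_m -> R -> R)
  (mu : 'I_n -> R) (i : 'I_m) : R := rbar i * p i (@phi m n eps kappa mu i).

Definition flow m n (eps : R) kappa rbar p (mu : 'I_n -> R) (i : 'I_m) (j : 'I_n) : R :=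
  @rate m n eps kappa rbar p mu i * @delta m n eps kappa mu i j.

Definition qdot m n (T eps : R) (c : 'I_n -> R) kappa rbar p (q : 'I_n -> R) (j : 'I_n) : R :=
  \sum_(i < m) @flow m n eps kappa rbar p (mu_vec T c q) i j - q j / T.

Definition is_equilibrium m n (T eps : R) (c : 'I_n -> R) kappa rbar p
  (X : 'I_m -> 'I_n -> R) (q : 'I_n -> R) (mu : 'I_n -> R) (r : 'I_m -> R) : Prop :=
  [/\ forall j, mu j = mu_of T (c j) (q j),
      forall i, r i = rbar i * p i (@phi m n eps kappa mu i),
      forall i j, X i j = r i * @delta m n eps kappa mu i j &
      forall j, \sum_(i < m) X i j - q j / T = 0].

Definition W m n (T eps : R) (c : 'I_n -> R) kappa (U : 'I_m -> R -> R)
  (r : 'I_m -> R) (mu : 'I_n -> R) : R :=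
  \sum_(i < m) (r i * @phi m n eps kappa mu i - U i (r i))
  + \sum_(j < n) c j * ln (1 - mu j / T).

Definition in_rbox m (rbar : 'I_m -> R) (r : 'I_m -> R) : Prop :=
  forall i, 0 <= r i <= rbar i.

Definition in_mubox n (T : R) (mu : 'I_n -> R) : Prop :=
  forall j, 0 <= mu j < T.

Definition is_saddle m n (T eps : R) c kappa U (rbar : 'I_m -> R)
  (rs : 'I_m -> R) (mus : 'I_n -> R) : Prop :=
  [/\ in_rbox rbar rs, in_mubox T mus &
      forall r mu, in_rbox rbar r -> in_mubox T mu ->
        @W m n T eps c kappa U rs mu <= @W m n T eps c kappa U rs mus /\
        @W m n T eps c kappa U rs mus <= @W m n T eps c kappa U r mus].

Definition beta (c q : R) : R :=
  \int[@lebesgue_measure R]_(s in `[0, q]) Num.max (1 - c / s) 0.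

Definition Jobj m n (T eps : R) (c : 'I_n -> R) kappa (r : 'I_m -> R)
  (X : 'I_m -> 'I_n -> R) (q : 'I_n -> R) : R :=
  \sum_(i < m) \sum_(j < n) kappa i j * X i j
  + \sum_(j < n) beta (c j) (q j)
  + eps * \sum_(i < m) \sum_(j < n) X i j * ln (X i j / r i).

Definition feasible m n (T : R) (r : 'I_m -> R)
  (X : 'I_m -> 'I_n -> R) (q : 'I_n -> R) : Prop :=
  [/\ forall i j, 0 <= X i j,
      forall i, \sum_(j < n) X i j = r i &
      forall j, \sum_(i < m) X i j = q j / T].

Definition is_program_min m n (T eps : R) c kappa (r : 'I_m -> R)
  (X : 'I_m -> 'I_n -> R) (q : 'I_n -> R) : Prop :=
  feasible T r X q /\
  forall X' q', feasible T r X' q' ->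
    @Jobj m n T eps c kappa r X q <= @Jobj m n T eps c kappa r X' q'.

Definition concave_on (A : set R) (f : R -> R) : Prop :=
  forall x y t, A x -> A y -> 0 <= t <= 1 ->
    (1 - t) * f x + t * f y <= f ((1 - t) * x + t * y).

Definition strictly_concave_on (A : set R) (f : R -> R) : Prop :=
  forall x y t, A x -> A y -> x != y -> 0 < t < 1 ->
    (1 - t) * f x + t * f y < f ((1 - t) * x + t * y).

End EV.

(* Main.v *)
Require Import Defs.
From HB Require Import structures.
From mathcomp Require Import all_boot all_order all_algebra.
From mathcomp Require Import all_classical all_reals all_analysis.
From mathcomp Require Import ring lra.
Set Implicit Arguments. Unset Strict Implicit. Unset Printing Implicit Defensive.
Import Order.TTheory GRing.Theory Num.Theory.
Import numFieldNormedType.Exports.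
Local Open Scope classical_set_scope.
Local Open Scope ring_scope.

(** The total inflow [F mu] into the stations is the gradient of the concave
function [mu |-> \sum_i min_r (r phi_i(mu) - U_i r)], hence a decreasing
(antimonotone) field, while the delay [mu_j(q_j)] is a nondecreasing function
of the queue.

- Existence: maximise the concave dual [D mu = min_r W(r, mu)] over a compact
  box inside [[0, T)^n]; its first-order (KKT) conditions say exactly that
  [q = T F(mu)] and [mu] is the delay vector of [q].
- Uniqueness of the equilibrium and the two variational characterisations
  follow from (strict) concavity and from Gibbs' inequality.
- Convergence: let [V q] be the Bregman divergence, from [q*] to [q], of a
  separable primitive of [mu / T].  Antimonotonicity of [F] gives
  [dV/dt <= - \sum_j (mu_j - mu*_j) (q_j - q*_j) / T^2 <= - V / T], so [V] decays
  exponentially.  As the delays are Lipschitz, [V] controls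
  [\sum_j (mu_j - mu*_j)^2], hence [mu] converges, and then [q] converges because
  it solves [dq/dt = F(mu) - q / T] with a converging forcing term. *)

(** * Tangent inequalities for the logarithm, and derivatives obtained from subgradients *)

Lemma ln_leB1 (R : realType) (x : R) : 0 < x -> ln x <= x - 1.
Proof.
move=> x0; have := @expR_ge1Dx R (ln x); rewrite lnK ?posrE//; lra.
Qed.

Lemma ln_ltB1 (R : realType) (x : R) : 0 < x -> x != 1 -> ln x < x - 1.
Proof.
move=> x0 x1; have lnx0 : ln x != 0 by rewrite ln_eq0.
have := expR_gt1Dx lnx0; rewrite lnK ?posrE//; lra.
Qed.

Lemma lnB_le (R : realType) (a b : R) : 0 < a -> 0 < b ->
  ln b - ln a <= (b - a) / a.
Proof.
move=> a0 b0; rewrite -ln_div ?posrE// mulrBl divff ?gt_eqF//.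
by apply: ln_leB1; rewrite divr_gt0.
Qed.

Lemma lnB_lt (R : realType) (a b : R) : 0 < a -> 0 < b -> a != b ->
  ln b - ln a < (b - a) / a.
Proof.
move=> a0 b0 ab; rewrite -ln_div ?posrE// mulrBl divff ?gt_eqF//.
apply: ln_ltB1; first by rewrite divr_gt0.
by apply: contra ab => /eqP h; rewrite -(divfK (lt0r_neq0 a0) b) h mul1r.
Qed.

(** Termwise Gibbs' inequality. At [x = 0] the factor [x] absorbs the default value of [ln 0]. *)
Lemma xlnx_ge (R : realType) (x y : R) : 0 <= x -> 0 < y ->
  x - y <= x * ln (x / y).
Proof.
rewrite le_eqVlt => /predU1P[<-|x0] y0; first by rewrite mul0r sub0r oppr_le0 ltW.
have := lnB_le x0 y0; rewrite -(ler_pM2l x0) mulrCA mulfV ?gt_eqF// mulr1.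
rewrite ln_div ?posrE//; lra.
Qed.

Lemma xlnx_eq (R : realType) (x y : R) : 0 <= x -> 0 < y ->
  x * ln (x / y) = x - y -> x = y.
Proof.
rewrite le_eqVlt => /predU1P[<-|x0] y0; first by rewrite mul0r; lra.
move=> h; apply/eqP/negP => /negP xy.
have := lnB_lt x0 y0 xy; rewrite -(ltr_pM2l x0) mulrCA mulfV ?gt_eqF// mulr1.
move: h; rewrite ln_div ?posrE//; lra.
Qed.

(* The difference quotients at [x] lie between [g x] and [g y]. *)
Lemma is_derive_subgradient (R : realType) (f g : R -> R) (x : R) :
  (forall x y, g x * (y - x) <= f y - f x) -> {for x, continuous g} ->
  is_derive x 1 f (g x).
Proof.
move=> sub cg; apply/is_derive1_caratheodory.
exists (fun z => if z == x then g x else (f z - f x) / (z - x)).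
rewrite eqxx; split=> // [z|].
  case: eqVneq => [->|zx]; first by rewrite !subrr mulr0.
  by rewrite divfK// subr_eq0.
apply/cvgrPdist_le => e e0 /=; rewrite eqxx.
have /cvgrPdist_le/(_ e e0) := cg; apply: filterS => z /=.
case: eqVneq => [->|zx]; first by rewrite subrr normr0.
apply: le_trans; have := sub x z; have := sub z x.
have zx0 : z - x != 0 by rewrite subr_eq0.
set d := _ / _; have -> : f z - f x = d * (z - x) by rewrite /d divfK.
have -> : f x - f z = - d * (z - x) by rewrite mulNr /d divfK// opprB.
have [zx_lt|zx_gt] : z - x < 0 \/ 0 < z - x by apply/orP; rewrite -neq_lt.
- rewrite -(opprB z x) mulrN -mulNr !ler_nM2r// => h1 h2.
  by rewrite !ger0_norm; lra.
- rewrite -(opprB z x) mulrN -mulNr !ler_pM2r// => h1 h2.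
  by rewrite !ler0_norm; lra.
Qed.

(** * The delay function, its convex primitive and the Bregman divergence *)

Section delay.
Variable R : realType.
Implicit Types T c q : R.

Lemma mu_ofE T c q : mu_of T c q = T * mu_of 1 c q.
Proof. by rewrite /mu_of; case: ifP => _; rewrite ?mulr0 ?mul1r. Qed.

(** Truncating [q] from below at [c] removes the case split, so that monotonicity and the Lipschitz
    bound come from those of [Num.max]. *)
Lemma mu_of_max c q : 0 < c -> mu_of 1 c q = 1 - c / Num.max q c.
Proof.
move=> c0; rewrite /mu_of; case: leP => qc; last by rewrite mul1r.
by rewrite divff ?gt_eqF// subrr.
Qed.

Lemma mu_of_lipschitz c x y : 0 < c ->
  `|mu_of 1 c x - mu_of 1 c y| <= `|x - y| / c.
Proof.
move=> c0; rewrite !mu_of_max//.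
have xc : c <= Num.max x c by rewrite le_max lexx orbT.
have yc : c <= Num.max y c by rewrite le_max lexx orbT.
have : `|Num.max x c - Num.max y c| <= `|x - y|.
  have := ler_norm (x - y); have := ler_norm (y - x); rewrite distrC => h1 h2.
  have := normr_ge0 (x - y) => h0.
  by rewrite ler_norml /Num.max; case: ltP => ?; case: ltP => ?; lra.
move: (Num.max x c) (Num.max y c) xc yc => a b ac bc ab.
have a0 : 0 < a by lra. have b0 : 0 < b by lra.
have -> : 1 - c / a - (1 - c / b) = (a - b) * (c / (a * b)).
  by field; rewrite !gt_eqF.
rewrite normrM; apply: ler_pM => //.
rewrite ger0_norm; last by rewrite divr_ge0 ?mulr_ge0 ?ltW.
rewrite ler_pdivrMr ?mulr_gt0// mulrC ler_pdivlMr//.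
by apply: ler_pM => //; exact: ltW.
Qed.

Lemma mu_of_continuous c : 0 < c -> continuous (mu_of 1 c).
Proof.
move=> c0 x; apply/cvgrPdist_le => e e0; near=> y.
apply: (le_trans (mu_of_lipschitz _ _ c0)); rewrite ler_pdivrMr//.
near: y; move: (e * c) (mulr_gt0 e0 c0) => {}e {}e0.
by have /cvgrPdist_le/(_ e e0) : id z @[z --> x] --> x by exact: cvg_id.
Unshelve. all: by end_near. Qed.

Lemma mu_of_nondecreasing c : 0 < c -> {homo mu_of 1 c : x y / x <= y}.
Proof.
move=> c0 x y xy; rewrite !mu_of_max// lerD2l lerN2 ler_pM2l//.
rewrite lef_pV2 ?posrE ?lt_max ?c0 ?orbT//.
by rewrite ge_max !le_max xy lexx !orbT.
Qed.

(** The convex primitive of [mu_of 1 c] that vanishes up to [c], in closed form; for [0 <= q] it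
    equals [beta c q]. *)
Definition mu_potential c q : R := if q <= c then 0 else q - c - c * ln (q / c).

Lemma mu_potential_subgradient c q q' : 0 < c ->
  mu_of 1 c q * (q' - q) <= mu_potential c q' - mu_potential c q.
Proof.
move=> c0.
(* Convexity of the logarithmic branch. At [c] both its value and its slope vanish, so the mixed
   cases follow by using [h] with [c] as one endpoint. *)
have h a b : 0 < a -> 0 < b ->
    (1 - c / a) * (b - a) <= (b - c - c * ln (b / c)) - (a - c - c * ln (a / c)).
  move=> a0 b0; rewrite !ln_div ?posrE//.
  have := lnB_le a0 b0; rewrite -(ler_pM2l c0) => h.
  have -> : (1 - c / a) * (b - a) = b - a - c * ((b - a) / a) by ring.
  lra.
have hc : c - c - c * ln (c / c) = 0 by rewrite divff ?gt_eqF// ln1; lra.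
rewrite /mu_of /mu_potential; case: (leP q c) => qc; case: (leP q' c) => q'c; rewrite ?mul1r.
- by rewrite mul0r subrr.
- have q'0 : 0 < q' by lra.
  by have := h _ _ c0 q'0; rewrite hc divff ?gt_eqF// subrr !mul0r; lra.
- have q0 : 0 < q by lra.
  have := h _ _ q0 c0; rewrite hc; apply: le_trans.
  rewrite ler_wpM2l; [by []| |lra].
  by rewrite subr_ge0 ler_pdivrMr// mul1r ltW.
- by apply: h; lra.
Qed.

Lemma is_derive_mu_potential c q : 0 < c ->
  is_derive q 1 (mu_potential c) (mu_of 1 c q).
Proof.
move=> c0; apply: is_derive_subgradient; last exact: mu_of_continuous.
by move=> x y; exact: mu_potential_subgradient.
Qed.

Definition mu_bregman c q' q : R :=
  mu_potential c q - mu_potential c q' - mu_of 1 c q' * (q - q').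

Lemma mu_bregman_ge0 c q' q : 0 < c -> 0 <= mu_bregman c q' q.
Proof. by move=> c0; rewrite subr_ge0 mu_potential_subgradient. Qed.

(** The two sides differ by the divergence with its arguments exchanged, which is nonnegative. *)
Lemma mu_bregman_le c q' q : 0 < c ->
  mu_bregman c q' q <= (mu_of 1 c q - mu_of 1 c q') * (q - q').
Proof.
by move=> c0; have := mu_potential_subgradient q q' c0; rewrite /mu_bregman; lra.
Qed.

(* Compare the Bregman divergence at [q] and one gradient step away from it. *)
Lemma mu_bregman_cocoercive c q' q : 0 < c ->
  (mu_of 1 c q - mu_of 1 c q') ^+ 2 * c <= 4 * mu_bregman c q' q.
Proof.
move=> c0; set d := _ - _.
pose y := q - d * c / 2.
have Vy := mu_bregman_ge0 q' y c0.
have := mu_potential_subgradient y q c0.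
have := mu_of_lipschitz q y c0.
have -> : q - y = d * c / 2 by rewrite /y; lra.
have -> : `|d * c / 2| / c = `|d| / 2.
  rewrite !normrM normfV (gtr0_norm c0) normr_nat; field.
  by rewrite gt_eqF.
move=> hlip.
have hd : (d * c / 2) * (mu_of 1 c q - mu_of 1 c y) <= (d * c / 2) * (d / 2).
  apply: (le_trans (ler_norm _)); rewrite normrM.
  apply: (@le_trans _ _ (`|d * c / 2| * (`|d| / 2))); first by rewrite ler_wpM2l.
  rewrite -[X in _ * X](_ : `|d / 2| = _); last by rewrite normrM normfV normr_nat.
  rewrite -normrM ger0_norm//.
  have -> : d * c / 2 * (d / 2) = d ^+ 2 * c / 4 by field.
  by rewrite divr_ge0// mulr_ge0 ?sqr_ge0 ?ltW.
move: Vy hd; rewrite /mu_bregman.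
have -> : y - q' = q - q' - d * c / 2 by rewrite /y; ring.
have : mu_of 1 c q = mu_of 1 c q' + d by rewrite /d; ring.
move: (mu_of 1 c q) (mu_of 1 c q') (mu_of 1 c y) => a b e -> Vy hd hs.
suff : d ^+ 2 * c = 4 * (d * c / 2 * (d / 2)) by nra.
by field.
Qed.

End delay.

(** Fundamental theorem of calculus for the primitive [mu_potential c]. *)
Lemma betaE (R : realType) (c q : R) : 0 < c -> 0 <= q ->
  beta c q = mu_potential c q.
Proof.
move=> c0 q0; rewrite /beta.
pose f : R -> R := mu_of 1 c.
have cf : continuous f by exact: mu_of_continuous.
have itf a b : lebesgue_measure.-integrable `[a, b] (EFin \o f).
  apply: continuous_compact_integrable; first exact: segment_compact.
  by apply: continuous_subspaceT => x; exact: cf.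
have itf0 : lebesgue_measure.-integrable `]0, q] (EFin \o f).
  apply: integrableS (itf 0 q) => //.
  by apply: subset_itvr; rewrite bnd_simp.
(* At [s = 0] the integrand is [1], because [0^-1 = 0], whereas [f 0 = 0]; hence the half-open
   interval, which carries the same integral. *)
have fE : {in `]0, q]%classic, f =1 (fun s => Num.max (1 - c / s) 0)}.
  move=> s; rewrite inE/= in_itv/= => /andP[s0 _]; rewrite /f /mu_of.
  case: leP => sc.
    by apply/esym/max_idPr; rewrite subr_le0 ler_pdivlMr// mul1r.
  rewrite mul1r; apply/esym/max_idPl.
  by rewrite subr_ge0 ler_pdivrMr// mul1r ltW.
have {1}-> : \int[lebesgue_measure]_(s in `[0, q]) Num.max (1 - c / s) 0 =
    \int[lebesgue_measure]_(s in `[0, q]) f s.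
  rewrite -Rintegral_itv_obnd_cbnd; last first.
    apply: eq_integrable itf0 => // s sI /=; congr EFin; exact: fE.
  rewrite -[RHS]Rintegral_itv_obnd_cbnd//.
  by apply: eq_Rintegral => s /fE.
have p0 : mu_potential c 0 = 0 by rewrite /mu_potential ltW.
move: q0; rewrite le_eqVlt => /predU1P[<-|q0].
  by rewrite set_itv1 Rintegral_set1 p0.
have dP x : is_derive x (1 : R) (mu_potential c) (f x).
  exact: is_derive_mu_potential.
have cP : continuous (mu_potential c).
  move=> x; apply: differentiable_continuous; apply/derivable1_diffP.
  exact: ex_derive.
rewrite /Rintegral (@continuous_FTC2 _ f (mu_potential c) 0 q)//.
- by rewrite p0 /= subr0.
- by apply: continuous_subspaceT => x; exact: cf.
- split; first by move=> x _; exact: ex_derive.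
  + by apply: cvg_at_right_filter; exact: cP.
  + by apply: cvg_at_left_filter; exact: cP.
- by move=> x _; rewrite derive1E; exact: derive_val.
Qed.

(** * Linear differential inequalities and relaxation to a limit *)

(** Gronwall's argument: [expR (k * s) * w s] has a nonpositive derivative from [a] on. *)
Lemma expR_decay (R : realType) (w dw : R -> R) (k a t : R) :
  (forall s, a <= s -> is_derive s 1 w (dw s)) ->
  (forall s, a <= s -> dw s <= - k * w s) ->
  a <= t -> w t <= w a * expR (- (k * (t - a))).
Proof.
move=> dwP dwle ta.
pose f := fun s : R => expR (k * s) * w s.
pose df := fun s : R => expR (k * s) * (k * w s + dw s).
have dfP s : a <= s -> is_derive s 1 f (df s).
  move=> sa; have := dwP s sa => ?.
  have dl : is_derive s 1 (fun s : R => k * s) k.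
    by apply: is_derive_eq; rewrite scaler1.
  have de := is_derive1_comp (is_derive_expR (k * s)) dl.
  have := is_deriveM de (dwP s sa); rewrite /= => dm.
  apply: is_derive_eq dm _.
  by rewrite /df /= /GRing.scale /=; ring.
have cf : {within `[a, t], continuous f}.
  apply: derivable_within_continuous => x; rewrite in_itv/= => /andP[xa _].
  by have := dfP _ xa => ?; exact: ex_derive.
have dfin x : x \in `]a, t[ -> is_derive x 1 f (df x).
  by rewrite in_itv/= => /andP[xa _]; apply: dfP; exact: ltW.
have [s sat fE] := MVT_segment ta dfin cf.
have : f t - f a <= 0.
  rewrite fE mulr_le0_ge0 ?subr_ge0// mulr_ge0_le0 ?expR_ge0//.
  by move: sat; rewrite in_itv/= => /andP[/dwle]; lra.
rewrite subr_le0 /f -(ler_pM2l (expR_gt0 (- (k * t)))) mulrA -expRD addNr expR0 mul1r.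
rewrite mulrA -expRD mulrC => /le_trans; apply.
by rewrite [in leRHS](_ : - _ = - (k * t) + k * a)//; ring.
Qed.

Lemma cvg_expR_decay (R : realType) (C k a : R) : 0 < k ->
  C * expR (- (k * (t - a))) @[t --> +oo] --> 0.
Proof.
move=> k0; rewrite -[X in _ --> X](mulr0 C); apply: cvgM; first exact: cvg_cst.
have ky : k * (t - a) @[t --> +oo] --> +oo.
  apply/cvgryPge => A; near=> t.
  rewrite -ler_pdivrMl// lerBrDr; near: t; apply: nbhs_pinfty_ge; exact: num_real.
exact: (cvg_comp _ _ ky (@cvgr_expR R)).
Unshelve. all: by end_near. Qed.

(** Once [b] stays within [k * (e / 2)] of [k * l], both [w - (l + e / 2)] and [(l - e / 2) - w]
    satisfy the hypotheses of [expR_decay], so each is bounded above by a vanishing exponential. *)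
Lemma relaxation_cvg (R : realType) (w b : R -> R) (k l : R) : 0 < k ->
  (forall t : R, 0 <= t -> is_derive t 1 w (b t - k * w t)) ->
  b t @[t --> +oo] --> k * l -> w t @[t --> +oo] --> l.
Proof.
move=> k0 dw bl; apply/cvgrPdist_le => e e0.
have ke0 : 0 < k * (e / 2) by rewrite mulr_gt0// divr_gt0.
have /cvgrPdist_le/(_ _ ke0)[M [_ bM]] := bl.
(* The estimate on [b] holds strictly beyond [M], hence the shift by [1]. *)
pose a := Num.max 0 (M + 1).
have a0 : 0 <= a by rewrite le_max lexx.
have bk t : a <= t -> `|k * l - b t| <= k * (e / 2).
  move=> ta; apply: bM => /=; apply: lt_le_trans ta.
  by rewrite lt_max ltrDl ltr01 orbT.
have up t : a <= t -> w t - (l + e / 2) <= (w a - (l + e / 2)) * expR (- (k * (t - a))).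
  apply: (@expR_decay _ (fun s => w s - (l + e / 2)) (fun s => b s - k * w s)).
    move=> s sa; have := dw s (le_trans a0 sa) => ?.
    by apply: is_derive_eq; rewrite subr0.
  by move=> s /bk; rewrite ler_norml; lra.
have lo t : a <= t -> (l - e / 2) - w t <= ((l - e / 2) - w a) * expR (- (k * (t - a))).
  apply: (@expR_decay _ (fun s => (l - e / 2) - w s) (fun s => - (b s - k * w s))).
    move=> s sa; have := dw s (le_trans a0 sa) => ?.
    have dB : is_derive s 1 (cst (l - e / 2) - w) (0 - (b s - k * w s)).
      exact: is_deriveB.
    by apply: is_derive_eq dB _; rewrite sub0r.
  by move=> s /bk; rewrite ler_norml; lra.
have e20 : 0 < e / 2 by rewrite divr_gt0.
have /cvgr0_norm_le/(_ _ e20) hu := cvg_expR_decay (w a - (l + e / 2)) a k0.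
have /cvgr0_norm_le/(_ _ e20) hl := cvg_expR_decay ((l - e / 2) - w a) a k0.
near=> t.
have ta : a <= t by near: t; apply: nbhs_pinfty_ge; exact: num_real.
have : `|(w a - (l + e / 2)) * expR (- (k * (t - a)))| <= e / 2 by near: t.
have : `|((l - e / 2) - w a) * expR (- (k * (t - a)))| <= e / 2 by near: t.
rewrite !ler_norml => hl' hu'; have := up _ ta; have := lo _ ta; lra.
Unshelve. all: by end_near. Qed.

(** * Logit shares and the soft minimum [phi] *)

Section logit.
Variables (R : realType) (m n : nat) (eps : R) (kappa : 'I_m -> 'I_n -> R).
Variables (rbar : 'I_m -> R) (p : 'I_m -> R -> R).
Hypothesis n_gt0 : (0 < n)%N.
Hypothesis eps_gt0 : 0 < eps.
Hypothesis p_continuous : forall i, continuous (p i).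
Implicit Types (mu : 'I_n -> R) (i : 'I_m) (j : 'I_n).

Lemma Zsum_gt0 mu i : 0 < Zsum eps kappa mu i.
Proof.
rewrite /Zsum (bigD1 (Ordinal n_gt0))//=.
by rewrite ltr_pwDl ?expR_gt0// sumr_ge0// => k _; exact: expR_ge0.
Qed.

Lemma delta_gt0 mu i j : 0 < delta eps kappa mu i j.
Proof. by rewrite divr_gt0 ?expR_gt0// Zsum_gt0. Qed.

Lemma sum_delta mu i : \sum_(j < n) delta eps kappa mu i j = 1.
Proof.
rewrite /delta -mulr_suml -/(Zsum eps kappa mu i) divff//.
by rewrite gt_eqF// Zsum_gt0.
Qed.

Lemma delta_le1 mu i j : delta eps kappa mu i j <= 1.
Proof.
rewrite -(sum_delta mu i) (bigD1 j)//= lerDl.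
by rewrite sumr_ge0// => k _; rewrite ltW// delta_gt0.
Qed.

(** The logarithm of a share is affine in its own cost once [phi] is split off; this is how delays
    become multipliers in the entropic program. *)
Lemma ln_delta mu i j :
  eps * ln (delta eps kappa mu i j) = phi eps kappa mu i - (kappa i j + mu j).
Proof.
rewrite /delta ln_div ?posrE ?expR_gt0 ?Zsum_gt0// expRK /phi.
by field; rewrite gt_eqF.
Qed.

(* Jensen's inequality for [expR] with the weights [delta eps kappa mu i]. *)
Lemma phi_supergradient mu mu' i :
  phi eps kappa mu' i <= phi eps kappa mu i
    + \sum_(j < n) delta eps kappa mu i j * (mu' j - mu j).
Proof.
set s := \sum_(j < n) _.
have Z0 := Zsum_gt0 mu i; have Z'0 := Zsum_gt0 mu' i.
suff : - s / eps <= ln (Zsum eps kappa mu' i / Zsum eps kappa mu i).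
  rewrite ler_pdivrMr// ln_div ?posrE// /phi; lra.
rewrite -ler_expR lnK ?posrE ?divr_gt0//.
have -> : Zsum eps kappa mu' i / Zsum eps kappa mu i =
    \sum_(j < n) delta eps kappa mu i j * expR (- (mu' j - mu j) / eps).
  rewrite /Zsum mulr_suml; apply: eq_bigr => j _.
  rewrite /delta mulrAC -expRD -/(Zsum eps kappa mu i); congr (expR _ / _).
  by field; rewrite gt_eqF.
(* The tangent to [expR] at the mean exponent [- s / eps]: its linear terms average to zero under
   the weights. *)
have -> : expR (- s / eps) = \sum_(j < n) delta eps kappa mu i j *
    (expR (- s / eps) * (1 + (- (mu' j - mu j) / eps - - s / eps))).
  transitivity (\sum_(j < n) (expR (- s / eps) * (1 + s / eps) * delta eps kappa mu i j
     - expR (- s / eps) / eps * (delta eps kappa mu i j * (mu' j - mu j)))).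
    rewrite sumrB -!mulr_sumr sum_delta -/s; ring.
  apply: eq_bigr => j _; ring.
apply: ler_sum => j _; rewrite ler_pM2l ?delta_gt0//.
have {2}-> : - (mu' j - mu j) / eps = - s / eps + (- (mu' j - mu j) / eps - - s / eps).
  by ring.
by rewrite expRD ler_pM2l ?expR_gt0// expR_ge1Dx.
Qed.

(** * Continuity along an arbitrary filter, to serve neighbourhoods, one-sided limits and [+oo]
    alike *)

Section cvg.
Variables (S : Type) (F : set_system S) (FF : Filter F).
Variables (x : S -> 'I_n -> R) (mu : 'I_n -> R).
Hypothesis cvgx : forall j, x t j @[t --> F] --> mu j.

Lemma cvg_expR_cost i j :
  expR (- (kappa i j + x t j) / eps) @[t --> F] --> expR (- (kappa i j + mu j) / eps).
Proof.
apply: continuous_cvg; first exact: continuous_expR.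
apply: cvgM; last exact: cvg_cst.
by apply: cvgN; apply: cvgD => //; exact: cvg_cst.
Qed.

Lemma cvg_Zsum i : Zsum eps kappa (x t) i @[t --> F] --> Zsum eps kappa mu i.
Proof.
by apply: cvg_big => [|j _]; [exact: add_continuous|exact: cvg_expR_cost].
Qed.

Lemma cvg_phi i : phi eps kappa (x t) i @[t --> F] --> phi eps kappa mu i.
Proof.
apply: cvgM; [exact: cvg_cst|]; apply: continuous_cvg; last exact: cvg_Zsum.
by apply: continuous_ln; exact: Zsum_gt0.
Qed.

Lemma cvg_delta i j :
  delta eps kappa (x t) i j @[t --> F] --> delta eps kappa mu i j.
Proof.
apply: cvgM; first exact: cvg_expR_cost.
by apply: cvgV; [rewrite gt_eqF// Zsum_gt0|exact: cvg_Zsum].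
Qed.

Lemma cvg_rate i : rate eps kappa rbar p (x t) i @[t --> F] --> rate eps kappa rbar p mu i.
Proof.
by apply: cvgM; [exact: cvg_cst|]; apply: continuous_cvg; [exact: p_continuous|exact: cvg_phi].
Qed.

Lemma cvg_flow i j :
  flow eps kappa rbar p (x t) i j @[t --> F] --> flow eps kappa rbar p mu i j.
Proof. by apply: cvgM; [exact: cvg_rate|exact: cvg_delta]. Qed.

End cvg.
End logit.

(** * Elastic demand: surplus, inflow and their subgradients *)

Section elastic.
Variables (R : realType) (m n : nat).
Variables (c : 'I_n -> R) (kappa : 'I_m -> 'I_n -> R) (T eps : R).
Variables (rbar : 'I_m -> R) (p : 'I_m -> R -> R) (U : 'I_m -> R -> R).
Hypotheses (n_gt0 : (0 < n)%N) (c_gt0 : forall j, 0 < c j).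
Hypotheses (T_gt0 : 0 < T) (eps_gt0 : 0 < eps) (rbar_gt0 : forall i, 0 < rbar i).
Hypothesis p_continuous : forall i, continuous (p i).
Hypothesis p_neg : forall i (tau : R), tau <= 0 -> p i tau = 1.
Hypothesis p_dec : forall i x y, x <= y -> p i y <= p i x.
Hypothesis p_lim : forall i, p i x @[x --> +oo] --> (0 : R).
Hypothesis U_inc : forall i (x y : R), 0 <= x -> x <= y -> U i x <= U i y.
Hypothesis U_sconc : forall i, strictly_concave_on `[0, rbar i] (U i).
Hypothesis U_argmax : forall i (tau r : R), 0 <= tau -> 0 <= r ->
  U i r - tau * r <= U i (rbar i * p i tau) - tau * (rbar i * p i tau).
Implicit Types (mu q : 'I_n -> R) (r : 'I_m -> R) (i : 'I_m) (j : 'I_n) (tau : R).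

Local Notation phi := (phi eps kappa).
Local Notation delta := (delta eps kappa).
Local Notation rate := (rate eps kappa rbar p).
Local Notation flow := (flow eps kappa rbar p).

Lemma p_le1 i tau : p i tau <= 1.
Proof.
have [t0|t0] := leP tau 0; first by rewrite p_neg.
by rewrite -(p_neg i (lexx 0)) p_dec// ltW.
Qed.

Lemma p_ge0 i tau : 0 <= p i tau.
Proof.
apply: (cvgr_to_le (@p_lim i)); near=> x; apply: p_dec.
by near: x; apply: nbhs_pinfty_ge; exact: num_real.
Unshelve. all: by end_near. Qed.

Lemma demand_box i tau : 0 <= rbar i * p i tau <= rbar i.
Proof.
by rewrite mulr_ge0 ?p_ge0 ?(ltW (rbar_gt0 _))//= -[leRHS]mulr1 ler_pM2l ?p_le1.
Qed.

Lemma rate_in_rbox mu : in_rbox rbar (rate mu).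
Proof. by move=> i; exact: demand_box. Qed.

Lemma rate_ge0 mu i : 0 <= rate mu i.
Proof. by have /andP[] := rate_in_rbox mu i. Qed.

Lemma flow_ge0 mu i j : 0 <= flow mu i j.
Proof. by rewrite mulr_ge0 ?rate_ge0// ltW// delta_gt0. Qed.

Lemma flow_le mu i j : flow mu i j <= rbar i.
Proof.
rewrite -[leRHS]mulr1 ler_pM ?rate_ge0 ?delta_le1//; first by rewrite ltW// delta_gt0.
by have /andP[] := rate_in_rbox mu i.
Qed.

Lemma sum_flow mu i : \sum_(j < n) flow mu i j = rate mu i.
Proof. by rewrite -mulr_sumr sum_delta// mulr1. Qed.

(** The soft minimum [phi] may be negative, so optimality must extend to [tau < 0]. There demand
    saturates at [rbar i], which is optimal on the box because [U i] is nondecreasing. *)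
Lemma U_argmax_box i tau (r : R) : 0 <= r <= rbar i ->
  U i r - tau * r <= U i (rbar i * p i tau) - tau * (rbar i * p i tau).
Proof.
move=> /andP[r0 rb]; have [t0|t0] := leP 0 tau; first exact: U_argmax.
rewrite p_neg ?mulr1; last exact: ltW.
have := U_inc i r0 rb; have : tau * (rbar i - r) <= 0.
  by rewrite mulr_le0_ge0 ?subr_ge0// ltW.
lra.
Qed.

(** By strict concavity, the midpoint of two distinct maximisers would do better than both. *)
Lemma U_argmax_unique i tau (r : R) : 0 <= r <= rbar i ->
  U i (rbar i * p i tau) - tau * (rbar i * p i tau) <= U i r - tau * r ->
  r = rbar i * p i tau.
Proof.
move=> rb; set r' := rbar i * p i tau => h; apply/eqP/negP => /negP rr'.
have r'b : 0 <= r' <= rbar i by exact: demand_box.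
have half : 0 < (1 / 2 : R) < 1 by lra.
have /(_ rb r'b rr' half) := @U_sconc i r r' (1 / 2).
have mb : 0 <= (1 - 1 / 2) * r + 1 / 2 * r' <= rbar i.
  by move: rb r'b; rewrite -(rwP andP) => -[? ?] /andP[? ?]; apply/andP; split; lra.
have := @U_argmax_box i tau _ mb; rewrite -/r'.
lra.
Qed.

(** The conjugate of [U i], that is the maximum of [U i r - tau * r] over [[0, rbar i]], written
    through its maximiser. *)
Definition surplus i tau : R := U i (rbar i * p i tau) - tau * (rbar i * p i tau).

(** Envelope argument: the maximiser at [tau] is a competitor at [tau']. *)
Lemma surplus_subgradient i tau tau' :
  - (rbar i * p i tau) * (tau' - tau) <= surplus i tau' - surplus i tau.
Proof.
have := U_argmax_box tau' (demand_box i tau); rewrite /surplus; lra.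
Qed.

Lemma surplus_continuous i : continuous (surplus i).
Proof.
move=> tau; have dS : is_derive tau 1 (surplus i) (- (rbar i * p i tau)).
  apply: (@is_derive_subgradient _ _ (fun tau => - (rbar i * p i tau))).
    exact: surplus_subgradient.
  apply: cvgN; apply: cvgM; first exact: cvg_cst.
  exact: p_continuous.
by apply: differentiable_continuous; apply/derivable1_diffP; exact: ex_derive.
Qed.

Lemma weighted_phi_supergradient r mu mu' : (forall i, 0 <= r i) ->
  \sum_(i < m) r i * (phi mu' i - phi mu i) <=
  \sum_(j < n) (\sum_(i < m) r i * delta mu i j) * (mu' j - mu j).
Proof.
move=> r0; apply: (@le_trans _ _ (\sum_(i < m) \sum_(j < n)
    r i * delta mu i j * (mu' j - mu j))).
  apply: ler_sum => i _; under eq_bigr do rewrite -mulrA.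
  rewrite -mulr_sumr ler_wpM2l// lerBlDl; exact: phi_supergradient.
by rewrite exchange_big/=; apply: ler_sum => j _; rewrite mulr_suml.
Qed.

Definition inflow mu j : R := \sum_(i < m) flow mu i j.

(** Chain rule for subgradients: [surplus] has the nonpositive slope minus the rate and [phi] is
    concave, so the composite is convex. *)
Lemma total_surplus_subgradient mu mu' :
  - \sum_(j < n) inflow mu j * (mu' j - mu j) <=
  \sum_(i < m) surplus i (phi mu' i) - \sum_(i < m) surplus i (phi mu i).
Proof.
have := weighted_phi_supergradient mu mu' (rate_ge0 mu).
rewrite -lerN2 => /le_trans; apply; rewrite -sumrN -sumrB.
by apply: ler_sum => i _; rewrite -mulNr; exact: surplus_subgradient.
Qed.

(** Sum of the subgradient inequalities from [mu] to [mu'] and back. *)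
Lemma inflow_antimonotone mu mu' :
  \sum_(j < n) (inflow mu j - inflow mu' j) * (mu j - mu' j) <= 0.
Proof.
have := lerD (total_surplus_subgradient mu mu') (total_surplus_subgradient mu' mu).
rewrite -opprD -big_split/= => h.
rewrite -oppr_ge0 -sumrN; set s := \sum_(j < n) _ in h *.
have -> : \sum_(j < n) - ((inflow mu j - inflow mu' j) * (mu j - mu' j)) = s.
  by apply: eq_bigr => j _; ring.
lra.
Qed.

(** * The dual function and its logarithmic barrier *)

Definition dual mu : R :=
  - \sum_(i < m) surplus i (phi mu i) + \sum_(j < n) c j * ln (1 - mu j / T).

Definition dual_grad mu j : R := inflow mu j - c j / (T - mu j).

Lemma barrier_supergradient (x y b : R) : 0 < b -> x < T -> y < T ->
  b * ln (1 - y / T) - b * ln (1 - x / T) <= - (b / (T - x)) * (y - x).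
Proof.
move=> b0 xT yT.
have p1 z : z < T -> 0 < 1 - z / T by move=> zT; rewrite subr_gt0 ltr_pdivrMr// mul1r.
rewrite -mulrBr; apply: (@le_trans _ _ (b * ((1 - y / T - (1 - x / T)) / (1 - x / T)))).
  by rewrite ler_pM2l// lnB_le ?p1.
rewrite le_eqVlt; apply/orP; left; apply/eqP; field.
by rewrite !gt_eqF ?subr_gt0 ?p1.
Qed.

(** Strictness of the logarithm's tangent inequality; the saddle point owes the uniqueness of its
    [mu] to it. *)
Lemma barrier_supergradient_eq (x y b : R) : 0 < b -> x < T -> y < T ->
  b * ln (1 - y / T) - b * ln (1 - x / T) = - (b / (T - x)) * (y - x) -> x = y.
Proof.
move=> b0 xT yT h; apply/eqP/negP => /negP xy.
have p1 z : z < T -> 0 < 1 - z / T by move=> zT; rewrite subr_gt0 ltr_pdivrMr// mul1r.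
have ne : 1 - x / T != 1 - y / T.
  apply: contra xy => /eqP e; apply/eqP.
  by apply: (mulIf (invr_neq0 (lt0r_neq0 T_gt0))); lra.
have := lnB_lt (p1 _ xT) (p1 _ yT) ne; rewrite -(ltr_pM2l b0) mulrBr h.
suff -> : b * ((1 - y / T - (1 - x / T)) / (1 - x / T)) = - (b / (T - x)) * (y - x).
  by rewrite ltxx.
by field; rewrite !gt_eqF ?subr_gt0 ?p1.
Qed.

Lemma dual_supergradient mu mu' : (forall j, mu j < T) -> (forall j, mu' j < T) ->
  dual mu' - dual mu <= \sum_(j < n) dual_grad mu j * (mu' j - mu j).
Proof.
move=> muT mu'T; have := total_surplus_subgradient mu mu'.
have : \sum_(j < n) c j * ln (1 - mu' j / T) - \sum_(j < n) c j * ln (1 - mu j / T)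
    <= \sum_(j < n) - (c j / (T - mu j)) * (mu' j - mu j).
  by rewrite -sumrB; apply: ler_sum => j _; exact: barrier_supergradient.
have -> : \sum_(j < n) dual_grad mu j * (mu' j - mu j) =
    \sum_(j < n) inflow mu j * (mu' j - mu j)
    + \sum_(j < n) - (c j / (T - mu j)) * (mu' j - mu j).
  by rewrite -big_split/=; apply: eq_bigr => j _; rewrite -mulrDl.
rewrite /dual; lra.
Qed.

Section cvg.
Variables (S : Type) (F : set_system S) (FF : Filter F).
Variables (x : S -> 'I_n -> R) (mu : 'I_n -> R).
Hypothesis cvgx : forall j, x t j @[t --> F] --> mu j.

Lemma cvg_inflow j : inflow (x t) j @[t --> F] --> inflow mu j.
Proof.
by apply: cvg_big => [|i _]; [exact: add_continuous|exact: cvg_flow].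
Qed.

Lemma cvg_dual_grad j : mu j < T -> dual_grad (x t) j @[t --> F] --> dual_grad mu j.
Proof.
move=> muT; apply: cvgB; first exact: cvg_inflow.
apply: cvgM; first exact: cvg_cst.
apply: cvgV; first by rewrite gt_eqF// subr_gt0.
by apply: cvgB => //; exact: cvg_cst.
Qed.

Lemma cvg_dual : (forall j, mu j < T) -> dual (x t) @[t --> F] --> dual mu.
Proof.
move=> muT; apply: cvgD.
  apply: cvgN; apply: cvg_big => [|i _]; first exact: add_continuous.
  by apply: continuous_cvg; [exact: surplus_continuous|exact: cvg_phi].
apply: cvg_big => [|j _]; first exact: add_continuous.
apply: cvgM; first exact: cvg_cst.
apply: continuous_cvg.
  by apply: continuous_ln; rewrite subr_gt0 ltr_pdivrMr// mul1r.
apply: cvgB; first exact: cvg_cst.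
by apply: cvgM => //; exact: cvg_cst.
Qed.

End cvg.

(** * Existence of a KKT point by compactness *)

Definition mu_shift mu j (h : R) : 'I_n -> R := fun k => mu k + h * (k == j)%:R.

(* At [mu_top j] the barrier term already exceeds any possible inflow, so the
   maximiser over the compact box does not touch its upper faces. *)
Definition mu_top j : R := T - c j / (\sum_(i < m) rbar i + 2 * (c j / T)).

Lemma mu_top_denom_gt0 j : 0 < \sum_(i < m) rbar i + 2 * (c j / T).
Proof.
rewrite ltr_wpDl//; last by rewrite mulr_gt0// divr_gt0.
by rewrite sumr_ge0// => i _; exact: ltW.
Qed.

Lemma mu_top_gt0 j : 0 < mu_top j.
Proof.
rewrite subr_gt0 ltr_pdivrMr ?mu_top_denom_gt0//.
have -> : T * (\sum_(i < m) rbar i + 2 * (c j / T)) = T * (\sum_(i < m) rbar i) + 2 * c j.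
  by field; rewrite gt_eqF.
have : 0 <= T * (\sum_(i < m) rbar i).
  by rewrite mulr_ge0 ?(ltW T_gt0)// sumr_ge0// => i _; exact: ltW.
by have := c_gt0 j; lra.
Qed.

(** First-order conditions with complementary slackness for [0 <= mu]; the bound [T] is never
    active, the barrier being infinite there. *)
Definition kkt mu : Prop := [/\ in_mubox T mu,
  forall j, dual_grad mu j <= 0 & forall j, 0 < mu j -> 0 <= dual_grad mu j].

Lemma inflow_le mu j : inflow mu j <= \sum_(i < m) rbar i.
Proof. by apply: ler_sum => i _; exact: flow_le. Qed.

Lemma inflow_ge0 mu j : 0 <= inflow mu j.
Proof. by apply: sumr_ge0 => i _; exact: flow_ge0. Qed.

(** The supergradient is taken at the shifted point and tested towards [mu]; this signs the gradient
    there, and [h] then tends to [0]. *)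
Lemma dual_shift_le mu j h : (forall k, mu k < T) -> (forall k, mu_shift mu j h k < T) ->
  dual (mu_shift mu j h) <= dual mu -> dual_grad (mu_shift mu j h) j * h <= 0.
Proof.
move=> muT buT le_dual; have := dual_supergradient buT muT.
rewrite (bigD1 j)//= big1 ?addr0; last first.
  by move=> k kj; rewrite /mu_shift (negbTE kj) mulr0 addr0 subrr mulr0.
have -> : mu j - mu_shift mu j h j = - h by rewrite /mu_shift eqxx mulr1; ring.
rewrite mulrN; lra.
Qed.

Lemma kkt_exists : exists mu, kkt mu.
Proof.
(* Row vectors carry the topology in which the box is compact and the extreme value theorem
   applies. *)
pose K := [set v : 'rV[R]_n | forall j, `[0, mu_top j]%classic (v ord0 j)].
have topT j : mu_top j < T by rewrite ltrBlDr ltrDl divr_gt0 ?mu_top_denom_gt0.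
have K0 : K !=set0.
  by exists 0 => j /=; rewrite mxE in_itv/= lexx ltW// mu_top_gt0.
have cK : compact K by apply: (@rV_compact _ _ (fun j => `[0, mu_top j]%classic)) => j; exact: segment_compact.
have KT v : K v -> forall j, v ord0 j < T.
  by move=> Kv j; have := Kv j; rewrite /= in_itv/= => /andP[_ /le_lt_trans]; apply.
have cf : {within K, continuous (fun v : 'rV[R]_n => dual (v ord0))}.
  apply: continuous_in_subspaceT => v; rewrite inE => Kv.
  apply: (@cvg_dual _ (nbhs v) _ (fun v : 'rV[R]_n => v ord0)); last exact: KT.
  by move=> j; exact: coord_continuous.
have [v] := EVT_max_rV K0 cK cf.
rewrite inE => Kv vmax; pose mu := v ord0; exists mu.
have mub j : 0 <= mu j <= mu_top j by have := Kv j; rewrite /= in_itv.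
have shiftP j h : 0 <= mu j + h <= mu_top j -> dual_grad (mu_shift mu j h) j * h <= 0.
  move=> hb; pose w : 'rV[R]_n := \row_k mu_shift mu j h k.
  have wE : w ord0 = mu_shift mu j h by apply/funext => k; rewrite mxE.
  have Kw : K w.
    move=> k /=; rewrite mxE in_itv/= /mu_shift; case: eqVneq => [->|_]; first by rewrite mulr1.
    by rewrite mulr0 addr0 mub.
  apply: dual_shift_le; first exact: KT.
    by move=> k; rewrite -wE; exact: KT.
  by rewrite -wE; apply: vmax; rewrite inE.
have cvg_shift j (F : set_system R) (FF : Filter F) : h @[h --> F] --> (0 : R) ->
    dual_grad (mu_shift mu j h) j @[h --> F] --> dual_grad mu j.
  move=> F0; apply: cvg_dual_grad => [k|]; last exact: KT.
  rewrite -[X in _ --> X]addr0 -[X in _ --> _ + X](mul0r (k == j)%:R).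
  by apply: cvgD; [exact: cvg_cst|apply: cvgM => //; exact: cvg_cst].
have ge0 j : 0 < mu j -> 0 <= dual_grad mu j.
  move=> mu0.
  have cb : dual_grad (mu_shift mu j h) j @[h --> (0 : R)^'-] --> dual_grad mu j.
    by apply: cvg_shift; apply: cvg_at_left_filter; exact: cvg_id.
  apply: (cvgr_to_ge cb); near=> h.
  have h0 : h < 0 by near: h; exact: nbhs_left_lt.
  have hm : - mu j < h by near: h; apply: nbhs_left_gt; rewrite oppr_lt0.
  have := shiftP j h; rewrite nmulr_lle0//; apply.
  by have /andP[_ ?] := mub j; apply/andP; split; lra.
(* Downward shifts are admissible on the upper face too, so [ge0] can exclude that face; this leaves
   room for the upward shifts behind [le0]. *)
have lt_top j : mu j < mu_top j.
  have /andP[_]:= mub j; rewrite le_eqVlt => /predU1P[muE|//].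
  have := mu_top_gt0 j; rewrite -muE => /ge0.
  have topE : c j / (T - mu_top j) = \sum_(i < m) rbar i + 2 * (c j / T).
    by rewrite /mu_top subKr invf_div mulrC divfK// gt_eqF.
  rewrite /dual_grad [in X in _ - X]muE topE.
  by have := inflow_le mu j; have := divr_gt0 (c_gt0 j) T_gt0; lra.
have le0 j : dual_grad mu j <= 0.
  have cb : dual_grad (mu_shift mu j h) j @[h --> (0 : R)^'+] --> dual_grad mu j.
    by apply: cvg_shift; apply: cvg_at_right_filter; exact: cvg_id.
  apply: (cvgr_to_le cb); near=> h.
  have h0 : 0 < h by near: h; exact: nbhs_right_gt.
  have hm : h < mu_top j - mu j by near: h; apply: nbhs_right_lt; rewrite subr_gt0.
  have := shiftP j h; rewrite pmulr_lle0//; apply.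
  by have /andP[? _] := mub j; apply/andP; split; lra.
split=> // j; have /andP[-> _] := mub j; exact: KT.
Unshelve. all: by end_near. Qed.

(** * From KKT points to equilibria, and uniqueness of the equilibrium *)

(** If [x = 0], the queue [T * f] is at most [b]; if [0 < x], it equals [T * b / (T - x)], which
    inverts the delay formula. *)
Lemma mu_of_kkt (b f x : R) : 0 < b -> 0 <= x < T ->
  f - b / (T - x) <= 0 -> (0 < x -> 0 <= f - b / (T - x)) -> x = mu_of T b (T * f).
Proof.
move=> b0 /andP[x0 xT] fle fge; rewrite /mu_of.
have Tx0 : 0 < T - x by rewrite subr_gt0.
move: x0; rewrite le_eqVlt => /predU1P[x0|x0].
  rewrite -x0 subr0 in fle *; rewrite ifT// mulrC -ler_pdivlMr//; lra.
have fE : f = b / (T - x) by apply/eqP; rewrite -subr_eq0 eq_le fle fge.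
have bT : b < T * f by rewrite fE mulrA ltr_pdivlMr// mulrC ltr_pM2r//; lra.
rewrite leNgt bT/= fE; field.
by rewrite !gt_eqF.
Qed.

Lemma kkt_equilibrium mu : kkt mu -> is_equilibrium T eps c kappa rbar p
  (flow mu) (fun j => T * inflow mu j) mu (rate mu).
Proof.
move=> [mub le0 ge0]; split=> // j; first by apply: mu_of_kkt; [| |exact: le0|exact: ge0].
by rewrite -/(inflow mu j) mulrAC divff ?gt_eqF// mul1r subrr.
Qed.

(** The delays determine all other components, so uniqueness reduces to [mu]. *)
Lemma equilibriumE X q mu r : is_equilibrium T eps c kappa rbar p X q mu r ->
  [/\ X = flow mu, q = (fun j => T * inflow mu j),
      mu = mu_vec T c q & r = rate mu].
Proof.
move=> [muE rE XE qE].
have rE' : r = rate mu by apply/funext => i; rewrite rE.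
have XE' : X = flow mu by apply/funext => i; apply/funext => j; rewrite XE rE'.
split=> //; apply/funext => j; last exact: muE.
have /eqP := qE j; rewrite XE' -/(inflow mu j) subr_eq0 => /eqP ->.
by rewrite mulrC divfK// gt_eqF.
Qed.

Lemma mu_vec_monotone q q' j : 0 <= (q j - q' j) * (mu_vec T c q j - mu_vec T c q' j).
Proof.
rewrite /mu_vec (mu_ofE _ _ (q j)) (mu_ofE _ _ (q' j)) -mulrBr mulrCA pmulr_rge0//.
have [qq'|q'q] := leP (q j) (q' j).
  by rewrite mulr_le0// subr_le0//; exact: mu_of_nondecreasing.
by rewrite mulr_ge0// subr_ge0 ?(ltW q'q)//; apply: mu_of_nondecreasing => //; exact: ltW.
Qed.

(** Inflow is antimonotone in the delays and delay is monotone in the queue, so each product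
    vanishes: at every station the inflows or the delays agree, and equal inflows give equal
    delays. *)
Lemma equilibrium_unique X q mu r X' q' mu' r' :
  is_equilibrium T eps c kappa rbar p X q mu r ->
  is_equilibrium T eps c kappa rbar p X' q' mu' r' ->
  [/\ X = X', q = q', mu = mu' & r = r'].
Proof.
move=> /equilibriumE[XE qE muE rE] /equilibriumE[XE' qE' muE' rE'].
suff mumu' : mu = mu' by rewrite XE XE' qE qE' rE rE' mumu'.
have mon j : 0 <= (inflow mu j - inflow mu' j) * (mu j - mu' j).
  have := mu_vec_monotone q q' j; rewrite -muE -muE' qE qE'.
  by rewrite -mulrBr -mulrA pmulr_rge0.
have /eqP : \sum_(j < n) (inflow mu j - inflow mu' j) * (mu j - mu' j) = 0.
  by apply/eqP; rewrite eq_le inflow_antimonotone sumr_ge0.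
rewrite psumr_eq0// => /allP/= eq0; apply/funext => j.
have := eq0 j; rewrite mem_index_enum mulf_eq0 !subr_eq0 => /(_ isT)/orP[/eqP fE|/eqP//].
by rewrite muE muE' /mu_vec qE qE' fE.
Qed.

(** * The saddle point of [W] *)

Lemma W_mu_leif r mu mu' : (forall i, 0 <= r i) -> in_mubox T mu -> in_mubox T mu' ->
  (forall j, \sum_(i < m) r i * delta mu i j - c j / (T - mu j) <= 0) ->
  (forall j, 0 < mu j -> 0 <= \sum_(i < m) r i * delta mu i j - c j / (T - mu j)) ->
  W T eps c kappa U r mu' <= W T eps c kappa U r mu ?= iff [forall j, mu' j == mu j].
Proof.
move=> r0 mub mub' le0 ge0.
have muT j : mu j < T by have /andP[] := mub j.
have mu'T j : mu' j < T by have /andP[] := mub' j.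
(* The loss in the barrier's tangent inequality, which vanishes only when [mu' j = mu j]. *)
pose gap j := - (c j / (T - mu j)) * (mu' j - mu j)
  - (c j * ln (1 - mu' j / T) - c j * ln (1 - mu j / T)).
have gap_ge0 j : 0 <= gap j by rewrite subr_ge0 barrier_supergradient.
have slack j : (\sum_(i < m) r i * delta mu i j - c j / (T - mu j)) * (mu' j - mu j) <= 0.
  have /andP[mu0 _] := mub j; have /andP[mu'0 _] := mub' j.
  move: mu0; rewrite le_eqVlt => /predU1P[mu0|mu0].
    by rewrite mulr_le0_ge0 ?le0// -mu0 subr0.
  have -> : \sum_(i < m) r i * delta mu i j - c j / (T - mu j) = 0.
    by apply/eqP; rewrite eq_le le0 ge0.
  by rewrite mul0r.
have Wle : W T eps c kappa U r mu' - W T eps c kappa U r mu <= - \sum_(j < n) gap j.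
  have := weighted_phi_supergradient mu mu' r0.
  have -> : W T eps c kappa U r mu' - W T eps c kappa U r mu =
      \sum_(i < m) r i * (phi mu' i - phi mu i)
      + \sum_(j < n) (c j * ln (1 - mu' j / T) - c j * ln (1 - mu j / T)).
    under [X in _ = X + _]eq_bigr do rewrite mulrBr.
    by rewrite /W !sumrB; ring.
  have slacks : \sum_(j < n)
      (\sum_(i < m) r i * delta mu i j - c j / (T - mu j)) * (mu' j - mu j) <= 0.
    by apply: sumr_le0.
  have -> : \sum_(j < n) (\sum_(i < m) r i * delta mu i j) * (mu' j - mu j) =
      \sum_(j < n) (\sum_(i < m) r i * delta mu i j - c j / (T - mu j)) * (mu' j - mu j)
      - \sum_(j < n) - (c j / (T - mu j)) * (mu' j - mu j).
    by rewrite -sumrB; apply: eq_bigr => j _; ring.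
  rewrite [\sum_(j < n) gap j]sumrB; lra.
split.
  by rewrite -subr_le0 (le_trans Wle)// oppr_le0 sumr_ge0.
apply/eqP/forallP => [WE j|muE]; last first.
  by congr W; apply/funext => j; exact/eqP.
move: Wle; rewrite WE subrr oppr_ge0 => gle.
have /eqP : \sum_(j < n) gap j = 0 by apply/eqP; rewrite eq_le gle sumr_ge0.
rewrite psumr_eq0// => /allP/(_ j); rewrite mem_index_enum => /(_ isT).
rewrite subr_eq0 => /eqP/esym/barrier_supergradient_eq -> //.
Qed.

Lemma W_rate_leif mu r : in_rbox rbar r ->
  W T eps c kappa U (rate mu) mu <= W T eps c kappa U r mu
    ?= iff [forall i, r i == rate mu i].
Proof.
move=> rb; pose gap i := (r i * phi mu i - U i (r i))
  - (rate mu i * phi mu i - U i (rate mu i)).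
have gap_ge0 i : 0 <= gap i.
  by have := U_argmax_box (phi mu i) (rb i); rewrite /gap /Defs.rate; lra.
have WE : W T eps c kappa U r mu - W T eps c kappa U (rate mu) mu = \sum_(i < m) gap i.
  by rewrite /gap sumrB /W; ring.
split; first by rewrite -subr_ge0 WE sumr_ge0.
apply/eqP/forallP => [Weq i|rE]; last by congr W; apply/funext => i; exact/esym/eqP.
have /eqP : \sum_(i < m) gap i = 0 by rewrite -WE Weq subrr.
rewrite psumr_eq0// => /allP/(_ i); rewrite mem_index_enum => /(_ isT)/eqP g0.
apply/eqP; apply: U_argmax_unique => //; move: g0; rewrite /gap /Defs.rate; lra.
Qed.

Lemma kkt_saddle mu : kkt mu -> is_saddle T eps c kappa U rbar (rate mu) mu.
Proof.
move=> [mub le0 ge0]; split=> //; first exact: rate_in_rbox.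
move=> r mu' rb mub'; split; last by apply: (W_rate_leif _ rb).1.
by apply: (W_mu_leif _ mub mub' le0 ge0).1 => i; exact: rate_ge0.
Qed.

(** The saddle inequalities of both pairs close the cycle [W r' mu <= W r' mu' <= W (rate mu) mu' <=
    W (rate mu) mu <= W r' mu], and the equality cases identify the points. *)
Lemma kkt_saddle_unique mu r' mu' : kkt mu ->
  is_saddle T eps c kappa U rbar r' mu' -> r' = rate mu /\ mu' = mu.
Proof.
move=> kmu [rb' mub' sad']; have [mub le0 ge0] := kmu.
have rb := rate_in_rbox mu.
have [h1 h2] := sad' _ _ rb mub.
have [h3 hr] := W_rate_leif mu rb'.
have [h4 hmu] := W_mu_leif (rate_ge0 mu) mub mub' le0 ge0.
split; apply/funext => k; apply/eqP.
  have /forallP/(_ k)// : [forall i, r' i == rate mu i].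
  by rewrite -hr eq_le h3/=; lra.
have /forallP/(_ k)// : [forall j, mu' j == mu j].
by rewrite -hmu eq_le h4/=; lra.
Qed.

(** * The convex program, through relative entropy *)

Lemma kl_leif (x r d : R) : 0 <= x -> 0 <= r -> 0 < d -> (r = 0 -> x = 0) ->
  x - r * d <= x * ln (x / r) - x * ln d ?= iff (x == r * d).
Proof.
move=> x0 r0 d0 rx; move: r0; rewrite le_eqVlt => /predU1P[r0|r0].
  by rewrite -r0 rx// !mul0r subrr; split.
have rd0 : 0 < r * d by rewrite mulr_gt0.
have E : x * ln (x / r) - x * ln d = x * ln (x / (r * d)).
  move: x0; rewrite le_eqVlt => /predU1P[<-|x0]; first by rewrite !mul0r subrr.
  by rewrite !ln_div ?posrE// lnM ?posrE//; ring.
rewrite E; split; first exact: xlnx_ge.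
apply/eqP/eqP => [/esym/(xlnx_eq x0 rd0)//|->].
by rewrite divff ?gt_eqF// ln1 mulr0 subrr.
Qed.

(** The terms of the relative entropy of [X] with respect to [flow mu]. The last difference makes
    each term nonnegative and cancels in the row sums of a feasible [X]. *)
Definition kl mu (X : 'I_m -> 'I_n -> R) i j : R :=
  X i j * ln (X i j / rate mu i) - X i j * ln (delta mu i j) - (X i j - flow mu i j).

(** Lagrangian form, with [mu j / T] as multiplier of the queue constraint: a constant, a separable
    function of [q], and a relative entropy. *)
Lemma JobjE mu X q : feasible T (rate mu) X q ->
  Jobj T eps c kappa (rate mu) X q =
  \sum_(i < m) rate mu i * phi mu i
  + \sum_(j < n) (beta (c j) (q j) - mu j / T * q j)
  + eps * \sum_(i < m) \sum_(j < n) kl mu X i j.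
Proof.
move=> [X0 Xr Xq].
have klE : \sum_(i < m) \sum_(j < n) kl mu X i j =
    \sum_(i < m) \sum_(j < n) X i j * ln (X i j / rate mu i)
    - \sum_(i < m) \sum_(j < n) X i j * ln (delta mu i j).
  rewrite -sumrB; apply: eq_bigr => i _.
  by rewrite /kl !sumrB Xr sum_flow subrr subr0.
have dE : eps * (\sum_(i < m) \sum_(j < n) X i j * ln (delta mu i j)) =
    \sum_(i < m) rate mu i * phi mu i - \sum_(i < m) \sum_(j < n) kappa i j * X i j
    - \sum_(j < n) mu j / T * q j.
  have -> : \sum_(j < n) mu j / T * q j = \sum_(i < m) \sum_(j < n) mu j * X i j.
    rewrite exchange_big/=; apply: eq_bigr => j _.
    by rewrite -mulr_sumr Xq mulrAC mulrA.
  rewrite mulr_sumr -!sumrB; apply: eq_bigr => i _.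
  rewrite -Xr mulr_suml mulr_sumr -!sumrB; apply: eq_bigr => j _.
  rewrite mulrCA ln_delta//; ring.
rewrite /Jobj klE mulrBr dE sumrB; ring.
Qed.

Lemma flow_kl_leif mu X q i j : feasible T (rate mu) X q ->
  X i j - flow mu i j <= X i j * ln (X i j / rate mu i) - X i j * ln (delta mu i j)
    ?= iff (X i j == flow mu i j).
Proof.
move=> [X0 Xr _]; apply: kl_leif => //; [exact: rate_ge0|exact: delta_gt0|].
move=> r0; have /eqP := Xr i; rewrite r0 psumr_eq0// => /allP/(_ j).
by rewrite mem_index_enum => /(_ isT)/eqP.
Qed.

Lemma kl_ge0 mu X q i j : feasible T (rate mu) X q -> 0 <= kl mu X i j.
Proof.
by move=> feas; rewrite subr_ge0 (flow_kl_leif i j feas).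
Qed.

Lemma kl_eq0 mu X q i j : feasible T (rate mu) X q ->
  (kl mu X i j == 0) = (X i j == flow mu i j).
Proof.
by move=> feas; rewrite subr_eq0 eq_sym (flow_kl_leif i j feas).
Qed.

Lemma flow_feasible mu : feasible T (rate mu) (flow mu) (fun j => T * inflow mu j).
Proof.
split=> [i j|i|j]; [exact: flow_ge0|exact: sum_flow|].
by rewrite mulrAC divff ?gt_eqF// mul1r.
Qed.

(** At the equilibrium queue the slope of [beta] is [mu j / T], so convexity handles the queue
    terms. The entropy left over yields both optimality and uniqueness. *)
Lemma program_min_kl mu X q : kkt mu -> feasible T (rate mu) X q ->
  Jobj T eps c kappa (rate mu) (flow mu) (fun j => T * inflow mu j)
    + eps * \sum_(i < m) \sum_(j < n) kl mu X i j
  <= Jobj T eps c kappa (rate mu) X q.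
Proof.
move=> kmu feas; have [X0 Xr Xq] := feas.
have feas' := flow_feasible mu.
rewrite (JobjE feas) (JobjE feas').
have -> : \sum_(i < m) \sum_(j < n) kl mu (flow mu) i j = 0.
  rewrite big1// => i _; rewrite big1// => j _.
  by apply/eqP; rewrite (kl_eq0 _ _ feas').
rewrite mulr0 addr0 lerD2r lerD2l; apply: ler_sum => j _.
have q0 : 0 <= q j.
  have Ti : 0 < T^-1 by rewrite invr_gt0.
  by rewrite -(pmulr_lge0 _ Ti) -Xq sumr_ge0.
rewrite !betaE ?mulr_ge0 ?inflow_ge0 ?(ltW T_gt0)//.
have [muE _ _ _] := kkt_equilibrium kmu.
have := mu_potential_subgradient (T * inflow mu j) (q j) (c_gt0 j).
have -> : mu_of 1 (c j) (T * inflow mu j) = mu j / T.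
  by rewrite [in RHS]muE (mu_ofE T) mulrAC divff ?gt_eqF// mul1r.
lra.
Qed.

Lemma kkt_program_min mu : kkt mu ->
  is_program_min T eps c kappa (rate mu) (flow mu) (fun j => T * inflow mu j).
Proof.
move=> kmu; split; first exact: flow_feasible.
move=> X q feas; apply: le_trans (program_min_kl kmu feas).
rewrite lerDl; apply: mulr_ge0; first exact: ltW.
by apply: sumr_ge0 => i _; apply: sumr_ge0 => j _; exact: kl_ge0 feas.
Qed.

Lemma kkt_program_unique mu X q : kkt mu ->
  is_program_min T eps c kappa (rate mu) X q ->
  X = flow mu /\ q = (fun j => T * inflow mu j).
Proof.
move=> kmu [feas Xmin].
have feas' := flow_feasible mu.
have kl0 := fun i j => @kl_ge0 mu X q i j feas.
have s0 i : 0 <= \sum_(j < n) kl mu X i j by rewrite sumr_ge0.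
have /eqP : \sum_(i < m) \sum_(j < n) kl mu X i j = 0.
  apply/eqP; rewrite eq_le sumr_ge0 ?andbT// -(pmulr_rle0 _ eps_gt0).
  by have := Xmin _ _ feas'; have := program_min_kl kmu feas; lra.
rewrite psumr_eq0// => /allP eq0.
have XE : X = flow mu.
  apply/funext => i; apply/funext => j; apply/eqP; rewrite -(kl_eq0 _ _ feas).
  have := eq0 i; rewrite mem_index_enum psumr_eq0// => /(_ isT)/allP/(_ j).
  by rewrite mem_index_enum => /(_ isT).
split=> //; apply/funext => j; have [_ _ Xq] := feas.
by have := Xq j; rewrite XE -/(inflow mu j) => ->; rewrite mulrC divfK// gt_eqF.
Qed.

(** * Convergence of trajectories *)

Section trajectory.
Variables (mus : 'I_n -> R) (q : R -> 'I_n -> R).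
Hypothesis kkt_mus : kkt mus.
Hypothesis q_ode : forall (t : R) j, 0 <= t ->
  is_derive t 1 (fun s => q s j) (qdot T eps c kappa rbar p (q t) j).

Local Notation qs := (fun j => T * inflow mus j).

Let mus_qs j : mus j = mu_vec T c qs j.
Proof. by have [muE _ _ _] := kkt_equilibrium kkt_mus; rewrite muE. Qed.

Definition lyapunov t : R := \sum_(j < n) mu_bregman (c j) (qs j) (q t j).

Definition lyapunov_dot t : R := \sum_(j < n)
  (mu_of 1 (c j) (q t j) - mu_of 1 (c j) (qs j)) * qdot T eps c kappa rbar p (q t) j.

Lemma is_derive_lyapunov (t : R) : 0 <= t -> is_derive t 1 lyapunov (lyapunov_dot t).
Proof.
move=> t0.
have -> : lyapunov = \sum_(j < n) (fun s => mu_bregman (c j) (qs j) (q s j)).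
  by apply/funext => s; rewrite fct_sumE.
apply: is_derive_sum => j; have dq := @q_ode t j t0.
have dB : is_derive (q t j) 1 (mu_bregman (c j) (qs j))
    (mu_of 1 (c j) (q t j) - mu_of 1 (c j) (qs j)).
  have dP := is_derive_mu_potential (q t j) (c_gt0 j).
  by apply: is_derive_eq; rewrite /= ?subr0 ?addr0 /GRing.scale/= ?mulr1.
exact: is_derive1_comp.
Qed.

Lemma lyapunov_dot_le t : lyapunov_dot t <= - T^-1 * lyapunov t.
Proof.
pose d j := mu_of 1 (c j) (q t j) - mu_of 1 (c j) (qs j).
have anti : \sum_(j < n) (inflow (mu_vec T c (q t)) j - inflow mus j) * d j <= 0.
  rewrite -(pmulr_rle0 _ T_gt0) mulr_sumr.
  have := inflow_antimonotone (mu_vec T c (q t)) mus.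
  congr (_ <= 0); apply: eq_bigr => j _; rewrite mus_qs /mu_vec.
  by rewrite (mu_ofE _ _ (q t j)) (mu_ofE _ _ (T * inflow mus j)) -mulrBr mulrCA.
(* Since [qs j / T] is the equilibrium inflow, [qdot] is the inflow difference minus
   [(q t j - qs j) / T]. *)
have -> : lyapunov_dot t =
    \sum_(j < n) (inflow (mu_vec T c (q t)) j - inflow mus j) * d j
    - T^-1 * \sum_(j < n) d j * (q t j - qs j).
  rewrite mulr_sumr -sumrB; apply: eq_bigr => j _.
  by rewrite /d /qdot -/(inflow _ j); field; rewrite gt_eqF.
have : \sum_(j < n) mu_bregman (c j) (qs j) (q t j) <= \sum_(j < n) d j * (q t j - qs j).
  by apply: ler_sum => j _; exact: mu_bregman_le.
have Ti : 0 < T^-1 by rewrite invr_gt0.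
rewrite -(ler_pM2l Ti) /lyapunov; lra.
Qed.

Lemma cvg_lyapunov : lyapunov t @[t --> +oo] --> 0.
Proof.
have Ti : 0 < T^-1 by rewrite invr_gt0.
apply: squeeze_cvgr (cvg_cst 0) (cvg_expR_decay (lyapunov 0) 0 Ti).
near=> t; have t0 : 0 <= t by near: t; apply: nbhs_pinfty_ge; exact: num_real.
rewrite sumr_ge0/=; last by move=> j _; exact: mu_bregman_ge0.
apply: (expR_decay _ _ t0); first exact: is_derive_lyapunov.
by move=> s _; exact: lyapunov_dot_le.
Unshelve. all: by end_near. Qed.

Lemma trajectory_cvg_mu j : mu_vec T c (q t) j @[t --> +oo] --> mus j.
Proof.
rewrite mus_qs /mu_vec mu_ofE.
under eq_cvg do rewrite mu_ofE.
apply: cvgM; first exact: cvg_cst.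
apply/cvgrPdist_le => e e0.
(* Chosen to match the factor [4] in [mu_bregman_cocoercive]. *)
have ce0 : 0 < e ^+ 2 * c j / 4 by rewrite divr_gt0// mulr_gt0// exprn_gt0.
have /cvgr0_norm_le/(_ _ ce0) := cvg_lyapunov; apply: filterS => t /= Vt.
have := mu_bregman_cocoercive (qs j) (q t j) (c_gt0 j).
have : mu_bregman (c j) (qs j) (q t j) <= lyapunov t.
  rewrite /lyapunov (bigD1 j)//= lerDl sumr_ge0// => k _; exact: mu_bregman_ge0.
have := le_trans (ler_norm _) Vt => h1 h2 h3.
rewrite distrC -(@ler_pXn2r _ 2) ?nnegrE ?(ltW e0)// real_normK ?num_real//.
by rewrite -(ler_pM2r (c_gt0 j)); lra.
Qed.

(** The delay is constant for queues up to [c j], so its convergence alone does not locate [q]; the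
    damping [- q j / T] does. *)
Lemma trajectory_cvg_q j : q t j @[t --> +oo] --> qs j.
Proof.
have Ti : 0 < T^-1 by rewrite invr_gt0.
apply: (relaxation_cvg (b := fun t => inflow (mu_vec T c (q t)) j) Ti).
  move=> t t0; apply: is_derive_eq (q_ode j t0) _.
  by rewrite /qdot mulrC.
rewrite mulrA mulVf ?gt_eqF// mul1r.
by apply: cvg_inflow; exact: trajectory_cvg_mu.
Qed.

End trajectory.
End elastic.

Theorem theorem4 (R : realType) (m n : nat)
  (c : 'I_n -> R) (kappa : 'I_m -> 'I_n -> R) (T eps : R)
  (rbar : 'I_m -> R) (p : 'I_m -> R -> R) (U : 'I_m -> R -> R)
  (hm : (0 < m)%N) (hn : (0 < n)%N)
  (hkappa : forall i j, 0 <= kappa i j)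
  (hc : forall j, 0 < c j) (hT : 0 < T) (heps : 0 < eps)
  (hrbar : forall i, 0 < rbar i)
  (* p_i = ccdf of a nonnegative continuous waiting-tolerance variable *)
  (hp_cont : forall i, continuous (p i))
  (hp_neg : forall i (tau : R), tau <= 0 -> p i tau = 1)
  (hp_dec : forall i x y, x <= y -> p i y <= p i x)
  (hp_lim : forall i, p i x @[x --> +oo] --> (0 : R))
  (* U_i increasing, concave, strictly concave on [0, rbar_i] *)
  (hU_inc : forall i (x y : R), 0 <= x -> x <= y -> U i x <= U i y)
  (hU_conc : forall i, concave_on [set x | 0 <= x] (U i))
  (hU_sconc : forall i, strictly_concave_on `[0, rbar i] (U i))
  (* r_i = argmax_{r >= 0} [U_i(r) - tau r] = rbar_i p_i(tau) *)
  (hU_argmax : forall i (tau r : R), 0 <= tau -> 0 <= r ->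
      U i r - tau * r <= U i (rbar i * p i tau) - tau * (rbar i * p i tau)) :
  exists (Xs : 'I_m -> 'I_n -> R) (qs : 'I_n -> R) (mus : 'I_n -> R) (rs : 'I_m -> R),
    [/\ (* (Xs, qs, mus, rs) is the unique equilibrium of the dynamics *)
        is_equilibrium T eps c kappa rbar p Xs qs mus rs,
        (forall X q mu r, is_equilibrium T eps c kappa rbar p X q mu r ->
            [/\ X = Xs, q = qs, mu = mus & r = rs]),
        (* (rs, mus) is the unique saddle point of W on the box *)
        is_saddle T eps c kappa U rbar rs mus /\
          (forall r mu, is_saddle T eps c kappa U rbar r mu -> r = rs /\ mu = mus),
        (* given rs, (Xs, qs) is the unique solution of the convex program *)
        is_program_min T eps c kappa rs Xs qs /\
          (forall X q, is_program_min T eps c kappa rs X q -> X = Xs /\ q = qs) &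
        (* every trajectory converges to the equilibrium *)
        forall q : R -> 'I_n -> R,
          (forall j, 0 <= q 0 j) ->
          (forall (t : R) j, 0 <= t ->
             is_derive t 1 (fun s => q s j) (qdot T eps c kappa rbar p (q t) j)) ->
          [/\ forall j, q t j @[t --> +oo] --> qs j,
              forall j, mu_vec T c (q t) j @[t --> +oo] --> mus j,
              forall i, rate eps kappa rbar p (mu_vec T c (q t)) i @[t --> +oo] --> rs i &
              forall i j, flow eps kappa rbar p (mu_vec T c (q t)) i j @[t --> +oo] --> Xs i j]].
Proof.
(* One KKT point furnishes the equilibrium, the saddle point, the program's solution and the
   limit. *)
have [mus kmu] : exists mu, kkt c kappa T eps rbar p mu.
  by apply: (@kkt_exists _ _ _ c kappa T eps rbar p U).
have cvg_mu := trajectory_cvg_mu hn hc hT heps hrbar hp_neg hp_dec hp_lim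
  hU_inc hU_argmax kmu.
exists (flow eps kappa rbar p mus), (fun j => T * inflow kappa eps rbar p mus j).
exists mus, (rate eps kappa rbar p mus); split.
- exact: kkt_equilibrium.
- move=> X q mu r equ; apply: (equilibrium_unique hn hc hT heps hrbar hp_neg hp_dec hp_lim
    hU_inc hU_argmax equ); exact: kkt_equilibrium.
- split; first exact: kkt_saddle.
  by move=> r mu; exact: kkt_saddle_unique.
- split; first exact: kkt_program_min.
  by move=> X q; exact: kkt_program_unique.
move=> q _ q_ode; split=> [j|j|i|i j].
- exact: (trajectory_cvg_q hn hc hT heps hrbar hp_cont hp_neg hp_dec hp_lim
    hU_inc hU_argmax kmu q_ode).
- exact: cvg_mu.
- by apply: cvg_rate => // j; exact: cvg_mu.
- by apply: cvg_flow => // k; exact: cvg_mu.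
Qed.
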